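(* Let $b_1,\dots,b_d\ge2$ be integers and $T_i(x)=b_ix\pmod 1$ on $[0,1]$. Let $x_o=(x_{o,1},\dots,x_{o,d})\in[0,1]^d$ and let $\psi_1,\dots,\psi_d:\mathbb N\to\mathbb R_+$ be positive functions. Then the Lebesgue measure of $$\mathfrak S(\Psi)=\Big\{x\in[0,1]^d:|T_i^nx_i-x_{o,i}|<\psi_i(n)\ \ \forall\,1\le i\le d,\ \text{for infinitely many } n\in\mathbb N\Big\}$$ is $0$ if $\sum_{n=1}^\infty\prod_{i=1}^d\psi_i(n)<\infty$ and $1$ if $\sum_{n=1}^\infty\prod_{i=1}^d\psi_i(n)=\infty$.
   Formalization: In the divergence case with d ≥ 2, each ψ_i is additionally assumed bounded; without this the claim fails, e.g. d = 2, ψ_1(n) = n², ψ_2(n) = n⁻², where the sum diverges but the measure is 0. *)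

(* Defs.v *)
From HB Require Import structures.
From mathcomp Require Import all_boot all_order all_algebra.
From mathcomp Require Import all_classical all_reals all_analysis.

Set Implicit Arguments.
Unset Strict Implicit.
Unset Printing Implicit Defensive.

Import Order.TTheory GRing.Theory Num.Theory.
Import numFieldNormedType.Exports.

Local Open Scope classical_set_scope.
Local Open Scope ring_scope.

Definition times_mod1 (R : realType) (b : nat) (x : R) : R :=
  b%:R * x - (Num.floor (b%:R * x))%:~R.

Definition tuple_of_pair (T : Type) (d : nat) (p : T * d.-tuple T) :
  d.+1.-tuple T := [tuple of p.1 :: p.2].

(* R^d is d.-tuple (measurableTypeR R), with its product (= Borel) sigma-algebra;
   d-dimensional Lebesgue measure is the iterated product of the one-dimensional
   one. The set function is given first; lebesgue_nd_sigma_finite_measure and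
   lebesgue_nd_box certify that it is the intended measure. *)
Fixpoint lebesgue_nd (R : realType) (d : nat) :
    set (d.-tuple (measurableTypeR R)) -> \bar R :=
  match d with
  | 0 => \d_[tuple]
  | d'.+1 => pushforward (lebesgue_measure \x lebesgue_nd (R := R) (d := d'))%E
                         (@tuple_of_pair (measurableTypeR R) d')
  end.

Arguments lebesgue_nd : clear implicits.

Lemma measurable_tuple_of_pair (R : realType) (d : nat) :
  measurable_fun setT (@tuple_of_pair (measurableTypeR R) d).
Proof. exact: measurable_cons. Qed.

Lemma lebesgue_nd_sigma_finite_measure (R : realType) (d : nat) :
  exists m : {sigma_finite_measure set (d.-tuple (measurableTypeR R)) -> \bar R},
    lebesgue_nd R d = m.
Proof.
elim: d => [|d [m mE]].
  by exists (\d_([tuple] : 0.-tuple (measurableTypeR R)) :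
    {sigma_finite_measure set _ -> \bar R}).
have mf := @measurable_tuple_of_pair R d.
pose f := @tuple_of_pair (measurableTypeR R) d.
pose mu_of : {measure set _ -> \bar R} := pushforward (lebesgue_measure \x m)%E f.
pose mu := mu_of mf.
have sf : sigma_finite setT mu.
  have /sigma_finiteP[F [TF ndF Foo]] := sigma_finiteT (@lebesgue_measure R).
  have /sigma_finiteP[G [TG ndG Goo]] := sigma_finiteT m.
  pose g (t : d.+1.-tuple (measurableTypeR R)) : measurableTypeR R * d.-tuple _ :=
    (thead t, [tuple of behead t]).
  have fK : cancel f g.
    by move=> [x t]; rewrite /g; congr (_, _); exact/val_inj.
  have mg : measurable_fun setT g.
    apply: measurable_fun_pair; last exact: measurable_behead.
    exact: measurable_tnth.
  exists (fun n => g @^-1` (F n `*` G n)).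
    rewrite -preimage_bigcup -(preimage_setT g); congr (g @^-1` _).
    rewrite -setXTT TF TG predeqE => -[x y]; split.
      move=> [/= [n _ Fnx] [k _ Gky]]; exists (maxn n k) => //; split.
      - by move: x Fnx; exact/subsetPset/ndF/leq_maxl.
      - by move: y Gky; exact/subsetPset/ndG/leq_maxr.
    by move=> [n _ []/= ? ?]; split; exists n.
  move=> k; have [mFk Fkoo] := Foo k; have [mGk Gkoo] := Goo k; split.
    by rewrite -[X in measurable X]setTI; apply: mg => //; exact: measurableX.
  rewrite /mu /mu_of /= /pushforward -comp_preimage.
  rewrite (_ : g \o f = id) ?preimage_id; last by apply/funext => p; exact: fK.
  by rewrite product_measure1E// lte_mul_pinfty// ge0_fin_numE.
pose nu := HB.pack_for {sigma_finite_measure set _ -> \bar R} (mu : set _ -> \bar R)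
  (Measure.on mu) (Measure_isSigmaFinite.Build _ _ _ mu sf).
by exists nu; rewrite /= mE.
Qed.

Lemma lebesgue_nd_box (R : realType) (d : nat)
    (A : 'I_d -> set (measurableTypeR R)) :
  (forall i, measurable (A i)) ->
  lebesgue_nd R d [set x | forall i, A i (tnth x i)] =
  (\prod_(i < d) lebesgue_measure (A i))%E.
Proof.
elim: d A => [|d IH] A mA.
  rewrite big_ord0 /= diracE mem_set// => -[]//.
have [m mE] := lebesgue_nd_sigma_finite_measure R d.
rewrite /= /pushforward big_ord_recl -IH// mE.
rewrite -product_measure1E//; last first.
  rewrite (_ : [set x | _] = \bigcap_(i in [set: 'I_d])
      ((fun x : d.-tuple (measurableTypeR R) => tnth x i) @^-1` A (lift ord0 i))).
    apply: fin_bigcap_measurable => // i _.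
    by rewrite -[X in measurable X]setTI; exact: measurable_tnth.
  by apply/seteqP; split => x /= Ax i; [move=> _|]; exact: Ax.
congr ((_ \x _)%E _); apply/seteqP; split => -[x t] /= Axt.
  split=> [|i]; first exact: (Axt ord0).
  by have := Axt (lift ord0 i); rewrite tnthS.
move=> i; case: (unliftP ord0 i) => [j ->|->]; last exact: Axt.1.
by rewrite tnthS; exact: Axt.2.
Qed.

(* The exponents range over n >= 1, but "infinitely many n" does not depend on
   whether n = 0 is allowed. *)
Definition shrinking_target (R : realType) (d : nat) (b : 'I_d -> nat)
    (xo : d.-tuple R) (psi : 'I_d -> nat -> R) :
    set (d.-tuple (measurableTypeR R)) :=
  [set x | (forall i, 0 <= (tnth x i : R) <= 1) /\
     forall N : nat, exists n : nat, (N <= n)%N /\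
       forall i, `|iter n (times_mod1 (b i)) (tnth x i : R) - tnth xo i| < psi i n].

(* Main.v *)
(* After n steps, T^n x = {b^n x}, so each coordinate condition is an arc
   condition on {b^n x_i}, and all events are boxes. The convergence half is the
   first Borel-Cantelli lemma. For the divergence half, replace each target by an
   arc of length r_i(n) = min(psi_i(n), 1/2) inside it. Covering an interval by
   b-adic cells shows that the events at times m < n have correlation at most
   (r_i(m) + 2 b_i^-(n-m)) r_i(n) in coordinate i, so the product over i exceeds
   the product of the measures by at most C 2^-(n-m) times the measure of the
   later event. Hence the number of events up to time K has variance bounded by a
   multiple of its mean, and Chebyshev's inequality gives full measure. *)
Require Import Defs.
From mathcomp Require Import all_boot all_order all_algebra.
From mathcomp Require Import all_classical all_reals all_analysis.
From mathcomp Require Import measurable_realfun.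
From mathcomp Require Import ring lra zify.

Import Order.TTheory GRing.Theory Num.Theory.

Set Implicit Arguments.
Unset Strict Implicit.
Unset Printing Implicit Defensive.

Local Open Scope classical_set_scope.
Local Open Scope ring_scope.

(** * Iterates of the maps, cells of mesh [1/q], and preimages of arcs *)

Lemma times_mod1_comp (R : realType) (b c : nat) (x : R) :
  times_mod1 b (times_mod1 c x) = times_mod1 (b * c) x.
Proof.
rewrite /times_mod1 mulrBr mulrA -natrM.
set f := Num.floor (c%:R * x).
rewrite (_ : b%:R * f%:~R = (b%:Z * f)%:~R :> R); last by rewrite intrM.
(* The integer [b * f] comes out of the outer floor and cancels. *)
rewrite floorDrz ?rpredN ?intr_int// intrD (@floorK _ (- _)) ?rpredN ?intr_int//.
by lra.
Qed.

(** For [n = 0] the two sides would be [x] and its fractional part, which differ outside [[0, 1[],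
    in particular at [x = 1]. *)
Lemma iter_times_mod1 (R : realType) (b n : nat) (x : R) : (0 < n)%N ->
  iter n (times_mod1 b) x = times_mod1 (b ^ n) x.
Proof.
case: n => // n _; elim: n => [|n IH]; first by rewrite expn1.
by rewrite iterS IH times_mod1_comp -expnS.
Qed.

Lemma measurable_times_mod1 (R : realType) (b : nat) :
  measurable_fun setT (@times_mod1 R b).
Proof.
have mb : measurable_fun setT (fun x : R => b%:R * x).
  by apply: measurable_funM.
have mf : measurable_fun setT (fun x : R => (Num.floor x)%:~R : R).
  by apply: nondecreasing_measurable => // x y xy; rewrite ler_int le_floor.
by apply: measurable_funB => //; exact: measurableT_comp mf mb.
Qed.

(** A run of [l] adjacent cells of length [1/q], so that measures can be computed by induction on
    [l]. Half-open ends make adjacent runs disjoint. *)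
Definition cell (R : realType) (q j l : nat) : set (measurableTypeR R) :=
  `[j%:R / q%:R, (j + l)%:R / q%:R[%classic.

Arguments cell : clear implicits.

(** The ends [a] and [b] may leave [[0, 1]]: a ball around a target near the boundary is allowed,
    and the upper bounds below still apply to it. *)
Definition in_arc (R : realType) (q : nat) (a b : R) :
  set (measurableTypeR R) := times_mod1 q @^-1` `]a, b[%classic.

Lemma measurable_in_arc (R : realType) (q : nat) (a b : R) :
  measurable (in_arc q a b).
Proof.
by rewrite /in_arc -[X in measurable X]setTI; exact: measurable_times_mod1.
Qed.

(** On the cell starting at [j/q] the floor of [q x] is [j], so the map is the affine function
    [q x - j] there. *)
Lemma cell1_in_arc (R : realType) (q j : nat) (a b : R) : (0 < q)%N ->
  cell R q j 1 `&` in_arc q a b =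
  cell R q j 1 `&` `](j%:R + a) / q%:R, (j%:R + b) / q%:R[%classic.
Proof.
move=> q0; have q0' : 0 < q%:R :> R by rewrite ltr0n.
apply/seteqP; split => x [] jx; rewrite /in_arc /=; move: (jx);
  rewrite /cell /= !in_itv/= ler_pdivrMr// !ltr_pdivlMr ?ltr_pdivrMr//;
  move=> /andP[x1 x2];
  rewrite /times_mod1.
all: have -> : Num.floor (q%:R * x) = j%:Z
  by apply/floor_def; rewrite intrD -!pmulrn mulrC x1/= (lt_le_trans x2)// natrD.
all: move=> /andP[ax xb]; split=> //; apply/andP; split; rewrite -?pmulrn in ax xb *; lra.
Qed.

Lemma cellS (R : realType) (q j l : nat) : (0 < q)%N ->
  cell R q j l.+1 = cell R q j l `|` cell R q (j + l) 1.
Proof.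
move=> q0; rewrite /cell addn1 -addnS.
rewrite -itv_bndbnd_setU// bnd_simp ler_pM2r ?invr_gt0 ?ltr0n// ler_nat.
  by rewrite leq_addr.
by rewrite leq_add2l.
Qed.

Lemma measure_cell_in_arc_le (R : realType) (q j l : nat) (a b : R) :
  (0 < q)%N -> a <= b ->
  (lebesgue_measure (cell R q j l `&` in_arc q a b)
     <= (l%:R * (b - a) / q%:R)%:E)%E.
Proof.
move=> q0 ab; have q0' : 0 < q%:R :> R by rewrite ltr0n.
have mc i m : measurable (cell R q i m) by exact: measurable_itv.
have mi := @measurable_in_arc R q a b.
elim: l => [|l IH].
  rewrite /cell addn0 set_itv_ge ?bnd_simp ?ltxx// set0I measure0 lee_fin.
  by rewrite !mul0r.
rewrite cellS// setIUl -natr1 !mulrDl mul1r EFinD.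
apply: (le_trans (measureU2 _ _ _)); try exact: measurableI.
apply: leeD => //; rewrite cell1_in_arc//.
apply: (@le_trans _ _ (lebesgue_measure
  (`](((j + l)%:R + a) / q%:R), (((j + l)%:R + b) / q%:R)[%classic : set R))).
  by apply: le_measure; rewrite ?inE//; exact: measurableI.
rewrite lebesgue_measure_itv /=; case: ifPn => _.
  by rewrite -EFinB lee_fin -mulrBl opprD addrACA subrr add0r.
by rewrite lee_fin divr_ge0 ?subr_ge0 // ltW.
Qed.

(** When the arc lies in [[0, 1]], its affine preimage stays inside each cell, so no length is lost
    and the upper bound is attained. *)
Lemma measure_cell_in_arc (R : realType) (q j l : nat) (a b : R) :
  (0 < q)%N -> 0 <= a -> a <= b -> b <= 1 ->
  lebesgue_measure (cell R q j l `&` in_arc q a b) = (l%:R * (b - a) / q%:R)%:E.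
Proof.
move=> q0 a0 ab b1; have q0' : 0 < q%:R :> R by rewrite ltr0n.
have mc i m : measurable (cell R q i m) by exact: measurable_itv.
have mi := @measurable_in_arc R q a b.
elim: l => [|l IH].
  by rewrite /cell addn0 set_itv_ge ?bnd_simp ?ltxx// set0I measure0 !mul0r.
rewrite cellS// setIUl -natr1 !mulrDl mul1r EFinD.
rewrite measureU//; try exact: measurableI; last first.
  rewrite setIACA setIid (_ : cell R q j l `&` _ = set0) ?set0I//.
  rewrite -subset0 => x []; rewrite /cell /= !in_itv/= => /andP[_ x1] /andP[x2 _].
  by move: (lt_le_trans x1 x2); rewrite ltxx.
congr (_ + _)%E => //; rewrite cell1_in_arc// setIidr; last first.
  move=> x; rewrite /cell /= !in_itv/= natrD => /andP[x1 x2].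
  apply/andP; split; [apply: le_trans (ltW x1)|apply: lt_le_trans x2 _];
   rewrite ler_pM2r ?invr_gt0//; lra.
apply: (etrans (lebesgue_measure_itv _)); rewrite /= lte_fin ltr_pM2r ?invr_gt0// ltrD2l.
case: ifPn => [_|]; first by rewrite -EFinB -mulrBl opprD addrACA subrr add0r.
(* The measure of an interval is given by cases; the empty interval occurs only for [a = b]. *)
by rewrite -leNgt => ba; rewrite (_ : b = a) ?subrr ?mul0r//; lra.
Qed.

Lemma cell_full (R : realType) (q : nat) : (0 < q)%N ->
  cell R q 0 q = `[0, 1[%classic.
Proof. by move=> q0; rewrite /cell mul0r add0n divff// pnatr_eq0 -lt0n. Qed.

(** The cells with indices from the floor of [q x] to that of [q y] cover the interval. There are at
    most [q (y - x) + 2] of them, each contributing at most [(b - a) / q]; the term [2 / q] pays for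
    the two end cells. *)
Lemma measure_itv_in_arc_le (R : realType) (q : nat) (x y a b : R) :
  (0 < q)%N -> 0 <= x -> x <= y -> a <= b ->
  (lebesgue_measure (`[x, y]%classic `&` in_arc q a b)
     <= ((y - x + 2 / q%:R) * (b - a))%:E)%E.
Proof.
move=> q0 x0 xy ab; have q0' : 0 < q%:R :> R by rewrite ltr0n.
have mi := @measurable_in_arc R q a b.
pose j := Num.truncn (q%:R * x); pose k := Num.truncn (q%:R * y).
have /andP[jx xj] := truncn_itv (mulr_ge0 (ltW q0') x0).
have /andP[ky yk] := truncn_itv (mulr_ge0 (ltW q0') (le_trans x0 xy)).
rewrite -/j -/k in jx xj ky yk.
have jk : (j <= k)%N by apply: le_truncn; rewrite ler_pM2l.
apply: (@le_trans _ _ (lebesgue_measure (cell R q j (k.+1 - j) `&` in_arc q a b))).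
  apply: le_measure; rewrite ?inE; try (apply: measurableI => //; exact: measurable_itv).
  apply: setSI => z; rewrite /cell /= !in_itv/= => /andP[xz zy].
  rewrite subnKC; last by rewrite leqW.
  rewrite ler_pdivrMr// ltr_pdivlMr// [z * _]mulrC; apply/andP; split.
    by rewrite (le_trans jx)// ler_pM2l.
  by rewrite (le_lt_trans _ yk)// ler_pM2l.
apply: (le_trans (@measure_cell_in_arc_le _ _ _ _ _ _ q0 ab)).
rewrite lee_fin -mulrAC ler_wpM2r ?subr_ge0// ler_pdivrMr// mulrDl mulfVK ?gt_eqF//.
rewrite natrB ?leqW// -natr1 in xj yk *.
by rewrite -natr1; lra.
Qed.

(** Inside one cell of mesh [1/q] the first condition confines [x] to a single interval of length
    [(b - a) / q], to which the covering bound at scale [q'] applies. The assumption [0 <= a] keeps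
    that interval in the nonnegative half-line. *)
Lemma measure_cell_in_arcI_le (R : realType) (q q' l : nat) (a b a' b' : R) :
  (0 < q)%N -> (0 < q')%N -> 0 <= a -> a <= b -> a' <= b' ->
  (lebesgue_measure (cell R q 0 l `&` (in_arc q a b `&` in_arc q' a' b'))
     <= (l%:R * (((b - a) / q%:R + 2 / q'%:R) * (b' - a')))%:E)%E.
Proof.
move=> q0 q'0 a0 ab ab'; have qr : 0 < q%:R :> R by rewrite ltr0n.
have mc i m : measurable (cell R q i m) by exact: measurable_itv.
have mi := @measurable_in_arc R q a b.
have mi' := @measurable_in_arc R q' a' b'.
elim: l => [|l IH].
  by rewrite /cell addn0 set_itv_ge ?bnd_simp ?ltxx// set0I measure0 mul0r.
rewrite cellS// setIUl -natr1 mulrDl mul1r EFinD add0n.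
apply: (le_trans (measureU2 _ _ _)); try by do ?apply: measurableI.
apply: leeD => //; rewrite setIA cell1_in_arc//.
have -> : (b - a) / q%:R = (l%:R + b) / q%:R - (l%:R + a) / q%:R.
  by rewrite -mulrBl opprD addrACA subrr add0r.
apply: le_trans (measure_itv_in_arc_le q'0 _ _ ab').
- apply: le_measure; rewrite ?inE; first by do ?apply: measurableI.
    by apply: measurableI => //; exact: measurable_itv.
  apply: setSI => x [_] /=; rewrite !in_itv/= => /andP[/ltW -> /ltW ->] //.
- by rewrite divr_ge0 ?addr_ge0 ?ler0n.
- by rewrite ler_pM2r ?invr_gt0// lerD2l.
Qed.

(** * Arc events in the unit interval and their correlations *)

Definition arc_event (R : realType) (q : nat) (a b : R) :
  set (measurableTypeR R) := `[0, 1[%classic `&` in_arc q a b.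

Lemma measurable_arc_event (R : realType) (q : nat) (a b : R) :
  measurable (arc_event q a b).
Proof. by apply: measurableI; [exact: measurable_itv|exact: measurable_in_arc]. Qed.

Lemma measure_arc_event (R : realType) (q : nat) (a b : R) :
  (0 < q)%N -> 0 <= a -> a <= b -> b <= 1 ->
  lebesgue_measure (arc_event q a b) = (b - a)%:E.
Proof.
move=> q0 a0 ab b1; rewrite /arc_event -(cell_full _ q0) measure_cell_in_arc//.
by rewrite mulrAC divff ?mul1r// pnatr_eq0 -lt0n.
Qed.

(** The unit interval consists of [c ^ m] cells, so the error [2 / c ^ n] per cell adds up to
    [2 / c ^ (n - m)], and [c >= 2]. *)
Lemma measure_arc_eventI_le (R : realType) (c m n : nat) (a b a' b' : R) :
  (2 <= c)%N -> (m <= n)%N -> 0 <= a -> a <= b -> a' <= b' ->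
  (lebesgue_measure (arc_event (c ^ m) a b `&` arc_event (c ^ n) a' b')
     <= (((b - a) + 2 / (2 ^+ (n - m))) * (b' - a'))%:E)%E.
Proof.
move=> c2 mn a0 ab ab'.
have c0 k : (0 < c ^ k)%N by rewrite expn_gt0; lia.
rewrite /arc_event setIACA setIid -(cell_full _ (c0 m)).
apply: (le_trans (measure_cell_in_arcI_le _ _ _ _ _ _)) => //.
rewrite lee_fin mulrA ler_wpM2r ?subr_ge0// mulrDr mulrCA divff ?mulr1; last first.
  by rewrite pnatr_eq0 -lt0n.
rewrite lerD2l mulrCA ler_pM2l// ler_pdivrMr ?ltr0n//.
have -> : (c ^ n = c ^ m * c ^ (n - m))%N by rewrite -expnD subnKC.
rewrite natrM mulrCA ler_peMr ?ler0n//.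
rewrite ler_pdivlMl ?exprn_gt0// mulr1 natrX lerXn2r ?nnegrE ?ler0n//.
by rewrite ler_nat.
Qed.

(** The arc starts at [x] if [x <= 1/2] and ends at [x] otherwise; the cap [1/2] on its length keeps
    it inside [[0, 1]]. *)
Lemma arc_inside_ball (R : realType) (x r : R) : 0 <= x <= 1 -> 0 < r ->
  exists2 a : R, [/\ 0 <= a & a + Num.min r 2^-1 <= 1] &
    forall z, a < z < a + Num.min r 2^-1 -> `|z - x| < r.
Proof.
move=> /andP[x0 x1] r0; set s := Num.min r 2^-1.
have sr : s <= r by rewrite ge_min lexx.
have s2 : s <= 2^-1 by rewrite ge_min lexx orbT.
have s0 : 0 < s by rewrite lt_min r0/= invr_gt0.
have [xh|xh] := leP x 2^-1.
  exists x; first by split; lra.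
  by move=> z /andP[z1 z2]; rewrite ltr_distlC; apply/andP; split; lra.
exists (x - s); first by split; lra.
by move=> z /andP[z1 z2]; rewrite ltr_distlC; apply/andP; split; lra.
Qed.

(* Expanding the product, every term but the first carries a factor [e] and is
   otherwise at most [1]. *)
Lemma prod_addr_le (R : realType) (d : nat) (r : 'I_d -> R) (e : R) :
  (forall i, 0 <= r i <= 1) -> 0 <= e <= 1 ->
  \prod_i (r i + e) <= \prod_i r i + (2 ^+ d - 1) * e.
Proof.
move=> r01 /andP[e0 e1]; elim: d r r01 => [|d IH] r r01.
  by rewrite !big_ord0 expr0 subrr mul0r addr0.
rewrite !big_ord_recl exprS.
have /andP[r0 r1] := r01 ord0.
have := IH (fun i => r (lift ord0 i)) (fun i => r01 _).
set P := \prod_(i < d) (_ + e); set Q := \prod_(i < d) _ => PQ.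
have Q0 : 0 <= Q by apply: prodr_ge0 => i _; have /andP[] := r01 (lift ord0 i).
have Q1 : Q <= 1 by apply: prodr_ile1 => i _; exact: r01.
have p1 : 1 <= 2 ^+ d :> R by rewrite exprn_ege1// ler1n.
have : (r ord0 + e) * P <= (r ord0 + e) * (Q + (2 ^+ d - 1) * e).
  by rewrite ler_wpM2l// addr_ge0.
move=> /le_trans; apply; set D := 2 ^+ d in p1 *.
have D0 : 0 <= (D - 1) * e by rewrite mulr_ge0// subr_ge0.
have : r ord0 * ((D - 1) * e) <= (D - 1) * e by rewrite ler_piMl.
have : e * ((D - 1) * e) <= (D - 1) * e by rewrite ler_piMl.
have : e * Q <= e by rewrite ler_piMr.
lra.
Qed.

(** * The second moment method for quasi-independent events *)

Section quasi_independence.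
Context d (T : measurableType d) (R : realType) (mu : {measure set T -> \bar R}).
Variables (D : set T) (E : nat -> set T) (p : nat -> R) (q : nat -> nat -> R).
Hypotheses (mD : measurable D) (muD : mu D = 1%E).
Hypotheses (mE : forall n, measurable (E n)) (ED : forall n, E n `<=` D).
Hypothesis muE : forall n, mu (E n) = (p n)%:E.
Hypothesis muEI : forall m n, (mu (E m `&` E n) <= (q m n)%:E)%E.

(* Integrate [t^2 1_A + 2 t S <= S^2 + t^2] over [D], where [S] is the sum of
   the indicators of the [E n] and [t] its mean. *)
Lemma measure_avoid_le (s : seq nat) (A : set T) : measurable A -> A `<=` D ->
  (forall n, n \in s -> A `&` E n = set0) ->
  (((\sum_(n <- s) p n) ^+ 2)%:E * mu A
     <= (\sum_(m <- s) \sum_(n <- s) q m n - (\sum_(n <- s) p n) ^+ 2)%:E)%E.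
Proof.
move=> mA AD AE; set t := \sum_(n <- s) p n.
have p0 n : 0 <= p n by rewrite -lee_fin -muE.
have t0 : 0 <= t by apply: sumr_ge0.
pose I (B : set T) (x : T) : \bar R := (\1_B x)%:E.
have I0 B (x : T) : (0 <= I B x)%E by rewrite lee_fin indicE.
have mI B : measurable B -> measurable_fun D (I B).
  by move=> mB; apply/measurable_EFinP; exact: measurable_indic.
have iI B : measurable B -> B `<=` D -> (\int[mu]_(x in D) I B x)%E = mu B.
  by move=> mB BD; rewrite integral_indic// setIidl.
pose f x := ((t ^+ 2)%:E * I A x + (2 * t)%:E * \sum_(n <- s) I (E n) x)%E.
pose g x := (\sum_(m <- s) \sum_(n <- s) I (E m `&` E n) x + (t ^+ 2)%:E * I D x)%E.
have mEI m n : measurable (E m `&` E n) by exact: measurableI.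
have ms1 : measurable_fun D (fun x => \sum_(n <- s) I (E n) x)%E.
  by apply: emeasurable_sum => n; exact: mI.
have ms2 m : measurable_fun D (fun x => \sum_(n <- s) I (E m `&` E n) x)%E.
  by apply: emeasurable_sum => n; exact: mI.
have ms3 : measurable_fun D (fun x => \sum_(m <- s) \sum_(n <- s) I (E m `&` E n) x)%E.
  by apply: emeasurable_sum => n; exact: ms2.
have s10 x : (0 <= \sum_(n <- s) I (E n) x)%E by apply: sume_ge0.
have s20 m x : (0 <= \sum_(n <- s) I (E m `&` E n) x)%E by apply: sume_ge0.
have s30 x : (0 <= \sum_(m <- s) \sum_(n <- s) I (E m `&` E n) x)%E by apply: sume_ge0.
have f_int : (\int[mu]_(x in D) f x = (t ^+ 2)%:E * mu A + (2 * t * t)%:E)%E.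
  rewrite ge0_integralD//.
  - rewrite !ge0_integralZl_EFin ?sqr_ge0 ?mulr_ge0//; last exact: mI.
    rewrite ge0_integral_sum// ?iI//; last by move=> n; exact: mI.
    congr (_ + _)%E; rewrite [RHS]EFinM; congr (_ * _)%E.
    by rewrite /t -sumEFin; apply: eq_bigr => n _; rewrite iI.
  - by move=> x _; rewrite mule_ge0// lee_fin sqr_ge0.
  - by apply: measurable_funeM; exact: mI.
  - by move=> x _; rewrite mule_ge0// lee_fin mulr_ge0.
  - exact: measurable_funeM.
have g_int : (\int[mu]_(x in D) g x
    <= (\sum_(m <- s) \sum_(n <- s) q m n)%:E + (t ^+ 2)%:E)%E.
  rewrite ge0_integralD//; last 2 first.
  - by move=> x _; rewrite mule_ge0// lee_fin sqr_ge0.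
  - by apply: measurable_funeM; exact: mI.
  rewrite ge0_integralZl_EFin ?sqr_ge0//; last exact: mI.
  rewrite iI// muD mule1 leeD2r// ge0_integral_sum// -sumEFin.
  apply: lee_sum => m _; rewrite ge0_integral_sum//; last by move=> n; exact: mI.
  rewrite -sumEFin; apply: lee_sum => n _; rewrite iI//.
  by move=> x [/ED].
have fg : (\int[mu]_(x in D) f x <= \int[mu]_(x in D) g x)%E.
  apply: ge0_le_integral => //.
  - by move=> x _; rewrite adde_ge0// mule_ge0// lee_fin ?sqr_ge0 ?mulr_ge0.
  - by apply: emeasurable_funD; apply: measurable_funeM => //; exact: mI.
  - by apply: emeasurable_funD => //; apply: measurable_funeM => //; exact: mI.
  move=> x Dx; rewrite /f /g /I.
  set S := \sum_(n <- s) \1_(E n) x : R.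
  have -> : (\sum_(n <- s) (\1_(E n) x)%:E)%E = S%:E by rewrite sumEFin.
  have -> : (\sum_(m <- s) \sum_(n <- s) (\1_(E m `&` E n) x)%:E)%E = (S * S)%:E.
    rewrite /S mulr_suml -sumEFin; apply: eq_bigr => m _.
    rewrite mulr_sumr -sumEFin; apply: eq_bigr => n _.
    by rewrite indicI.
  rewrite -!EFinM -!EFinD lee_fin [\1_D x]indicE mem_set// mulr1.
  (* On [A] the sum [S] vanishes and both sides equal [t ^ 2]; off [A] the inequality is
     [0 <= (S - t) ^ 2]. *)
  have [Ax|Ax] := pselect (A x).
    have -> : S = 0.
      rewrite /S big_seq big1// => n ns; rewrite indicE memNset// => Enx.
      by have : (A `&` E n) x by []; rewrite AE.
    by rewrite indicE mem_set// !mulr0 !mulr1; lra.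
  rewrite indicE memNset// mulr0 add0r.
  have : 0 <= (S - t) ^+ 2 by rewrite sqr_ge0.
  by rewrite expr2; lra.
rewrite f_int in fg; have := le_trans fg g_int.
have : mu A \is a fin_num.
  rewrite ge0_fin_numE//; apply: (@le_lt_trans _ _ (mu D)); last by rewrite muD ltry.
  by apply: le_measure; rewrite ?inE.
move=> /fineK <-; rewrite -!EFinM -!EFinD !lee_fin; lra.
Qed.
End quasi_independence.

Definition diverges (R : realType) (f : nat -> R) :=
  forall M : R, exists K : nat, M <= \sum_(0 <= n < K) f n.

Lemma diverges_tail (R : realType) (f : nat -> R) (N : nat) (M : R) :
  (forall n, 0 <= f n) -> diverges f -> exists K, M <= \sum_(N <= n < K) f n.
Proof.
move=> f0 /(_ (M + \sum_(0 <= n < N) f n))[K hK]; exists (N + K)%N.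
have : \sum_(0 <= n < K) f n <= \sum_(0 <= n < N + K) f n.
  rewrite [leRHS](@big_cat_nat _ _ _ K)//= ?leq_addl// lerDl.
  by apply: sumr_ge0.
rewrite (@big_cat_nat _ _ _ N 0 (N + K))//= ?leq_addr//; lra.
Qed.

(** With truncated subtraction the exponent is the distance between [n] and [m], so this is a
    two-sided geometric series with sum [1 + 2 = 3] over all integers. *)
Lemma sum_expr_dist_le (R : realType) (n K : nat) :
  \sum_(0 <= m < K) 2^-1 ^+ ((n - m) + (m - n)) <= 3 :> R.
Proof.
have h0 k : 0 <= 2^-1 ^+ k :> R by rewrite exprn_ge0.
(* A bound sharp enough for induction on [K]: the first form holds before the peak at [m = n], the
   second after it. *)
suff : \sum_(0 <= m < K) 2^-1 ^+ ((n - m) + (m - n))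
    <= (if (K <= n)%N then 2^-1 ^+ (n - K) else 3 - 2^-1 ^+ (K.-1 - n)) :> R.
  move=> /le_trans; apply; case: ifPn => _; last by have := h0 (K.-1 - n)%N; lra.
  by rewrite (@le_trans _ _ 1)// ?exprn_ile1//; lra.
elim: K => [|K IH]; first by rewrite big_geq.
rewrite big_nat_recr//=; move: IH; have [Kn|nK] := ltnP K n.
  rewrite (ltnW Kn) (eqP (ltnW Kn : K - n == 0)%N) addn0 -(subnSK Kn) exprS; lra.
have [Kn|] := leqP K n.
  have -> : K = n by apply/eqP; rewrite eqn_leq Kn.
  by rewrite !subnn addn0 expr0; lra.
move=> {}nK; rewrite (eqP (ltnW nK : n - K == 0)%N) add0n.
by case: K nK => // K; rewrite ltnS => nK /=; rewrite subSn// exprS; lra.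
Qed.

Section quasi_independent_limsup.
Context d (T : measurableType d) (R : realType) (mu : {measure set T -> \bar R}).
Variables (D : set T) (E : nat -> set T) (p : nat -> R) (C : R).
Hypotheses (mD : measurable D) (muD : mu D = 1%E).
Hypotheses (mE : forall n, measurable (E n)) (ED : forall n, E n `<=` D).
Hypothesis muE : forall n, mu (E n) = (p n)%:E.
Hypothesis C0 : 0 <= C.
Hypothesis muEI : forall m n, (mu (E m `&` E n) <=
  (p m * p n + C * ((p m + p n) * 2^-1 ^+ ((n - m) + (m - n))))%:E)%E.
Hypothesis pD : diverges p.

(** Over a window [N <= n < K] with mean [t], the second moment bound gives
    [t ^ 2 * mu A <= 6 * C * t]. Since [t] is unbounded in [K], [mu A] must vanish. *)
Lemma measure_avoid_tail (N : nat) :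
  mu (D `\` \bigcup_(n in [set n | (N <= n)%N]) E n) = 0%E.
Proof.
set A := D `\` _.
have p0 n : 0 <= p n by rewrite -lee_fin -muE.
have mA : measurable A.
  by apply: measurableD => //; apply: bigcup_measurable => n _.
have AD : A `<=` D by move=> x [].
have fA : mu A \is a fin_num.
  rewrite ge0_fin_numE//; apply: (@le_lt_trans _ _ (mu D)); last by rewrite muD ltry.
  by apply: le_measure; rewrite ?inE.
have sum_le (K : nat) (t := \sum_(N <= n < K) p n) : t ^+ 2 * fine (mu A) <= 6 * C * t.
  have tailE n : n \in index_iota N K -> A `&` E n = set0.
    rewrite mem_index_iota => /andP[Nn _]; rewrite -subset0 => x [[_ nE] Enx].
    by apply: nE; exists n.
  have := measure_avoid_le mD muD mE ED muE muEI mA AD tailE.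
  rewrite -(fineK fA) -EFinM lee_fin -/t => /le_trans; apply.
  (* The main terms sum to [t ^ 2] and cancel. By symmetry [p m + p n] counts twice, and the
     geometric series is at most [3], whence the constant [6 * C]. *)
  have -> : \sum_(N <= m < K) \sum_(N <= n < K)
       (p m * p n + C * ((p m + p n) * 2^-1 ^+ ((n - m) + (m - n)))) =
     t ^+ 2 + 2 * C * \sum_(N <= n < K)
        p n * \sum_(N <= m < K) 2^-1 ^+ ((n - m) + (m - n)).
    under eq_bigr do rewrite big_split/=.
    rewrite big_split/=; congr (_ + _).
      by rewrite expr2 /t mulr_suml; apply: eq_bigr => m _; rewrite mulr_sumr.
    under eq_bigr do rewrite -mulr_sumr.
    rewrite -mulr_sumr [2 * C]mulrC -mulrA; congr (_ * _).
    pose w m n : R := 2^-1 ^+ ((n - m) + (m - n)).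
    rewrite (eq_bigr (fun m => \sum_(N <= n < K) p m * w m n
        + \sum_(N <= n < K) p n * w m n)); last first.
      by move=> m _; rewrite -big_split/=; apply: eq_bigr => n _; rewrite mulrDl.
    rewrite big_split/= mulr_natl mulr2n; congr (_ + _).
      apply: eq_bigr => m _; rewrite mulr_sumr; apply: eq_bigr => n _.
      by rewrite addnC.
    rewrite exchange_big/=; apply: eq_bigr => n _.
    by rewrite mulr_sumr.
  rewrite addrAC subrr add0r (_ : 6 * C * t = 2 * C * (t * 3)); last by ring.
  rewrite ler_wpM2l ?mulr_ge0//; rewrite mulr_suml; apply: ler_sum => n _.
  rewrite ler_wpM2l//; apply: le_trans (sum_expr_dist_le _ n (N + K)).
  rewrite [leRHS](@big_cat_nat _ _ _ N)//= ?leq_addr//.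
  rewrite -[leLHS]add0r lerD//; first by apply: sumr_ge0 => m _; rewrite exprn_ge0.
  have [NK|KN] := leqP N K; last first.
    by rewrite big_geq 1?ltnW// sumr_ge0// => m _; rewrite exprn_ge0.
  rewrite [leRHS](@big_cat_nat _ _ _ K)//= ?leq_addl// lerDl.
  by apply: sumr_ge0 => m _; rewrite exprn_ge0.
rewrite -(fineK fA); congr EFin; apply/eqP; rewrite eq_le fine_ge0// andbT.
rewrite leNgt; apply/negP => a0; set a := fine (mu A) in a0 sum_le.
(* This [K] makes [t * a] at least [6 * C + 1], against the bound [t * a <= 6 * C]. *)
have [K] := @diverges_tail _ p N ((6 * C + 1) / a) p0 pD.
have := sum_le K; set t := \sum_(N <= n < K) p n => tC.
rewrite ler_pdivrMr// => Ct.
have t0 : 0 < t.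
  by rewrite -(pmulr_lgt0 _ a0) (lt_le_trans _ Ct)// ltr_wpDl// mulr_ge0.
have : t * (t * a) <= t * (6 * C) by rewrite mulrA -expr2 [leRHS]mulrC.
rewrite ler_pM2l// => /(le_trans Ct).
by rewrite -subr_ge0 opprD addrA subrr add0r oppr_ge0 ler10.
Qed.

(** The part of [D] outside the limsup is a countable union over [N] of the null sets of points that
    avoid all events from [N] on. *)
Lemma measure_lim_sup_set_eq1 : mu (lim_sup_set E) = 1%E.
Proof.
have mU N : measurable (\bigcup_(n in [set n | (N <= n)%N]) E n).
  by apply: bigcup_measurable => n _.
have mL : measurable (lim_sup_set E) by apply: bigcap_measurable => //; exists 0%N.
have LD : lim_sup_set E `<=` D.
  by move=> x /(_ 0%N I)[n _ /ED].
have N0 : mu (D `\` lim_sup_set E) = 0%E.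
  rewrite /lim_sup_set setDE setC_bigcap setI_bigcupr.
  apply: measure_negligible.
    by apply: bigcupT_measurable => N; apply: measurableI => //; exact: measurableC.
  apply: negligible_bigcup => N; apply/negligibleP.
    by apply: measurableI => //; exact: measurableC.
  exact: measure_avoid_tail.
rewrite -muD -(setDUK LD) measureU//; last 2 first.
- exact: measurableD.
- by rewrite setDE setICA setICr setI0.
by rewrite [X in (_ + X)%E]N0 adde0.
Qed.

End quasi_independent_limsup.

(** * Divergence of series and its survival under truncation at [1/2] *)

Lemma nneseries_succ (R : realType) (f : nat -> \bar R) :
  (forall n, (1 <= n)%N -> (0 <= f n)%E) ->
  (\sum_(1 <= n <oo) f n = \sum_(0 <= n <oo) f n.+1)%E.
Proof.
(* The sign of [f 0] is unknown, so that value is replaced by [0]. *)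
move=> f0; pose g n := if n is 0 then 0%E else f n.
transitivity (\sum_(1 <= n <oo) g n)%E.
  by rewrite eseries_cond [RHS]eseries_cond; apply: eq_eseriesr => -[].
rewrite -nneseries_addn; last by case=> // n; exact: f0.
by apply: eq_eseriesr => n _; rewrite addn1.
Qed.

Lemma nneseries_pinfty_diverges (R : realType) (f : nat -> R) :
  (forall n, 0 <= f n) -> (\sum_(0 <= n <oo) (f n)%:E = +oo)%E -> diverges f.
Proof.
move=> f0 foo M; apply: contrapT => /forallNP hM.
suff : (\sum_(0 <= n <oo) (f n)%:E <= M%:E)%E by rewrite foo leye_eq.
apply: lime_le; first by apply: is_cvg_nneseries => n _ _; rewrite lee_fin.
apply: nearW => K; rewrite sumEFin lee_fin; move: (hM K) => /negP.
by rewrite -ltNge => /ltW.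
Qed.

(** An unbounded [f] exceeds [1/2] at arbitrarily large indices, and each such index adds [1/2] to
    the truncated sum. *)
Lemma diverges_min (R : realType) (f : nat -> R) : (forall n, 0 < f n) ->
  (forall B, exists n, B < f n) -> diverges (fun n => Num.min (f n) 2^-1).
Proof.
move=> f0 fub M.
have g0 n : 0 <= Num.min (f n) 2^-1 by rewrite le_min (ltW (f0 n))/= invr_ge0.
have far N : exists2 n, (N <= n)%N & 2^-1 < f n.
  (* A value above [1/2] plus the sum of the first [N] values cannot be one of those values. *)
  have [n fn] := fub (2^-1 + \sum_(i < N) f i); exists n; last first.
    by apply: le_lt_trans fn; rewrite lerDl sumr_ge0// => i _; exact: ltW.
  rewrite leqNgt; apply/negP => nN; have := fn; apply/negP; rewrite -leNgt.
  rewrite (bigD1 (Ordinal nN))//= addrCA lerDl addr_ge0// sumr_ge0// => i _.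
  exact: ltW.
suff H k : exists K, k%:R / 2 <= \sum_(0 <= n < K) Num.min (f n) 2^-1.
  have [K hK] := H (Num.truncn (2 * `|M|)).+1; exists K; apply: le_trans hK.
  have := truncnS_gt (2 * `|M|); have := ler_norm M; lra.
elim: k => [|k [K hK]]; first by exists 0%N; rewrite big_geq// mul0r.
have [n Kn fn] := far K; exists n.+1; rewrite big_nat_recr//=.
rewrite [X in _ + X]min_r; last exact: ltW.
rewrite (@big_cat_nat _ _ _ K)//= -natr1 mulrDl mul1r lerD2r.
by apply: (le_trans hK); rewrite lerDl sumr_ge0.
Qed.

(** For bounded factors truncation costs only a constant factor. An unbounded factor can occur only
    for [d = 1], where [diverges_min] applies. *)
Lemma diverges_prod_min (R : realType) (d : nat) (f : 'I_d -> nat -> R) :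
  (0 < d)%N -> (forall i n, 0 < f i n) ->
  ((2 <= d)%N -> forall i, exists M, forall n, f i n <= M) ->
  diverges (fun n => \prod_i f i n) ->
  diverges (fun n => \prod_i Num.min (f i n) 2^-1).
Proof.
move=> d0 f0 fb fD.
have [/choice[B fB]|unb] := pselect (forall i, exists M, forall n, f i n <= M).
  (* Division by [B' i] does not increase [f i n], thanks to [1], and brings it to at most [1/2],
     thanks to [2 * B i]. *)
  pose B' i := Num.max 1 (2 * B i).
  have B'0 i : 0 < B' i by rewrite lt_max ltr01.
  have fB' i n : f i n / B' i <= Num.min (f i n) 2^-1.
    rewrite le_min !ler_pdivrMr// ler_peMr ?(ltW (f0 _ _))//=; last first.
      by rewrite le_max lexx.
    rewrite ler_pdivlMl// le_max; apply/orP; right.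
    by rewrite ler_pM2l.
  have P0 : 0 < \prod_i B' i by apply: prodr_gt0.
  move=> M; have [K hK] := fD (M * \prod_i B' i); exists K.
  rewrite -ler_pdivlMr// in hK; apply: le_trans hK _.
  rewrite mulr_suml; apply: ler_sum => n _; rewrite -prodfV -big_split/=.
  by apply: ler_prod => i _; rewrite fB' andbT divr_ge0// ltW.
have d1 : d = 1%N.
  by apply/eqP; rewrite eqn_leq d0 andbT leqNgt; apply/negP => /fb.
subst d; under [X in diverges X]funext do rewrite big_ord1.
apply: diverges_min => // B; apply: contrapT => /forallNP nB.
apply: unb => i; exists B => n; rewrite (ord1 i).
by rewrite leNgt; apply/negP/nB.
Qed.

(** * Boxes and measurability of the shrinking target set *)

Lemma measurable_tuple_box (R : realType) (d : nat)
    (A : 'I_d -> set (measurableTypeR R)) : (forall i, measurable (A i)) ->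
  measurable [set x : d.-tuple (measurableTypeR R) | forall i, A i (tnth x i)].
Proof.
move=> mA; rewrite (_ : [set x | _] = \bigcap_(i in [set: 'I_d])
    ((fun x : d.-tuple (measurableTypeR R) => tnth x i) @^-1` A i)).
  apply: fin_bigcap_measurable => // i _.
  by rewrite -[X in measurable X]setTI; exact: measurable_tnth.
by apply/seteqP; split => x /= Ax i; [move=> _|]; exact: Ax.
Qed.

Lemma measurable_shrinking_target (R : realType) (d : nat) (b : 'I_d -> nat)
    (xo : d.-tuple R) (psi : 'I_d -> nat -> R) :
  measurable (shrinking_target b xo psi).
Proof.
pose A n i : set (measurableTypeR R) :=
  iter n (times_mod1 (b i)) @^-1` `]tnth xo i - psi i n, tnth xo i + psi i n[%classic.
pose F n := [set x : d.-tuple (measurableTypeR R) | forall i, A n i (tnth x i)].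
have -> : shrinking_target b xo psi =
    [set x | forall i, `[0, 1]%classic (tnth x i)] `&` lim_sup_set F.
  apply/seteqP; split => x [x01 xF]; split.
  - by move=> i; rewrite /= in_itv/= x01.
  - move=> N _; have [n [Nn xn]] := xF N; exists n => // i.
    by rewrite /A /= in_itv/= -ltr_distl.
  - by move=> i; have := x01 i; rewrite /= in_itv/=.
  - move=> N; have [n Nn xn] := xF N I; exists n; split=> // i.
    by have := xn i; rewrite /A /= in_itv/= -ltr_distl.
have mT n i : measurable_fun setT (iter n (@times_mod1 R (b i))).
  elim: n => [|n IH]; first exact: measurable_id.
  exact: (measurableT_comp (@measurable_times_mod1 R (b i)) IH).
apply: measurableI.
  apply: (@measurable_tuple_box _ _ (fun=> `[0, 1]%classic)) => i.
  exact: measurable_itv.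
apply: bigcap_measurable; first by exists 0%N.
move=> N _; apply: bigcup_measurable => n _.
apply: (@measurable_tuple_box _ _ (A n)) => i.
by rewrite /A -[X in measurable X]setTI; exact: mT.
Qed.

Lemma lebesgue_nd_box_le (R : realType) (d : nat)
    (A : 'I_d -> set (measurableTypeR R)) (c : 'I_d -> R) :
  (forall i, measurable (A i)) ->
  (forall i, (lebesgue_measure (A i) <= (c i)%:E)%E) ->
  (lebesgue_nd R d [set x | forall i, A i (tnth x i)] <= (\prod_i c i)%:E)%E.
Proof.
move=> mA Ac; rewrite lebesgue_nd_box//.
have fA i : lebesgue_measure (A i) \is a fin_num.
  by rewrite ge0_fin_numE// (le_lt_trans (Ac i))// ltry.
rewrite (eq_bigr (fun i => (fine (lebesgue_measure (A i)))%:E)); last first.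
  by move=> i _; rewrite fineK.
rewrite prodEFin lee_fin; apply: ler_prod => i _; rewrite fine_ge0//=.
by rewrite -lee_fin fineK.
Qed.

(** * The convergence half *)

Lemma lebesgue_nd_shrinking_target_eq0 (R : realType) (d : nat)
    (b : 'I_d -> nat) (xo : d.-tuple R) (psi : 'I_d -> nat -> R) :
  (forall i, (0 < b i)%N) -> (forall i n, (1 <= n)%N -> 0 < psi i n) ->
  (\sum_(1 <= n <oo) (\prod_(i < d) psi i n)%:E < +oo)%E ->
  lebesgue_nd R d (shrinking_target b xo psi) = 0%E.
Proof.
move=> b0 psi0.
have prod0 n : (1 <= n)%N -> (0 <= (\prod_(i < d) psi i n)%:E)%E.
  by move=> n1; rewrite lee_fin prodr_ge0// => i _; exact/ltW/psi0.
rewrite nneseries_succ// => soo.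
have [m mE] := lebesgue_nd_sigma_finite_measure R d.
(* The extra cell in [cell R q 0 q.+1] covers the endpoint [1]. The exponent is [n.+1], so that the
   iterate is a single map [times_mod1]. *)
pose A n i : set (measurableTypeR R) := let q := (b i ^ n.+1)%N in
  cell R q 0 q.+1 `&` in_arc q (tnth xo i - psi i n.+1) (tnth xo i + psi i n.+1).
pose F n := [set x : d.-tuple (measurableTypeR R) | forall i, A n i (tnth x i)].
have q0 n i : (0 < b i ^ n.+1)%N by rewrite expn_gt0 b0.
have mA n i : measurable (A n i).
  by apply: measurableI; [exact: measurable_itv|exact: measurable_in_arc].
have mF n : measurable (F n) by exact: (measurable_tuple_box (mA n)).
(* In each coordinate the arc has length [2 * psi i n.+1] and the [q + 1] cells have total length
   [(q + 1) / q <= 2], hence the factor [4]. *)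
have Fle n : (m (F n) <= (4 ^+ d)%:E * (\prod_(i < d) psi i n.+1)%:E)%E.
  have -> : 4 ^+ d = \prod_(i < d) 4 :> R by rewrite prodr_const card_ord.
  rewrite -EFinM -big_split/= -mE.
  apply: lebesgue_nd_box_le => // i; have p0 := psi0 i n.+1 isT.
  apply: le_trans (measure_cell_in_arc_le _ _ (q0 n i) _) _; first by lra.
  rewrite lee_fin ler_pdivrMr ?ltr0n//.
  rewrite (_ : _ - _ = 2 * psi i n.+1); last by ring.
  have : 1 <= (b i ^ n.+1)%:R :> R by rewrite ler1n.
  rewrite -natr1; set Q := _%:R => Q1.
  rewrite -subr_ge0 (_ : _ - _ = 2 * psi i n.+1 * (Q - 1)); last by ring.
  by rewrite mulr_ge0 ?subr_ge0// mulr_ge0// ltW.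
have F0 : m (lim_sup_set F) = 0%E.
  apply: lim_sup_set_cvg0 => //.
  apply: (@le_lt_trans _ _
    (\sum_(0 <= n <oo) (4 ^+ d)%:E * (\prod_(i < d) psi i n.+1)%:E)%E).
    by apply: lee_nneseries => // n _; exact: Fle.
  rewrite nneseriesZl; last by move=> n _; exact: prod0.
  by rewrite lte_mul_pinfty// lee_fin exprn_ge0.
rewrite mE; apply: subset_measure0 F0.
- exact: measurable_shrinking_target.
- apply: bigcap_measurable; first by exists 0%N.
  by move=> N _; exact: bigcup_measurable.
(* Asking for an exponent at least [N.+1] rules out [0] and leaves an index at least [N] after the
   shift. *)
move=> x [x01 xS] N _; have [[|n] [Nn xn]] := xS N.+1; first by [].
exists n => // i; split.
  have /andP[x0 x1] := x01 i; rewrite /cell /= in_itv/= mul0r x0/= add0n.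
  by apply: (le_lt_trans x1); rewrite ltr_pdivlMr ?ltr0n// mul1r ltr_nat.
by rewrite /in_arc /= in_itv/= -ltr_distl -iter_times_mod1.
Qed.

(** * The divergence half *)

Lemma lebesgue_nd_shrinking_target_eq1 (R : realType) (d : nat)
    (b : 'I_d -> nat) (xo : d.-tuple R) (psi : 'I_d -> nat -> R) :
  (forall i, (2 <= b i)%N) -> (forall i, 0 <= tnth xo i <= 1) ->
  (forall i n, (1 <= n)%N -> 0 < psi i n) ->
  diverges (fun n => \prod_i Num.min (psi i n.+1) 2^-1) ->
  lebesgue_nd R d (shrinking_target b xo psi) = 1%E.
Proof.
move=> b2 xo01 psi0 rD.
have [m mE] := lebesgue_nd_sigma_finite_measure R d.
pose r n i : R := Num.min (psi i n.+1) 2^-1.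
have r0 n i : 0 < r n i by rewrite lt_min psi0//= invr_gt0.
have r1 n i : r n i <= 1 by rewrite ge_min; apply/orP; right; lra.
have /choice[a ha] (ni : nat * 'I_d) : exists a : R,
    (0 <= a /\ a + r ni.1 ni.2 <= 1) /\
    forall z, a < z < a + r ni.1 ni.2 -> `|z - tnth xo ni.2| < psi ni.2 ni.1.+1.
  have [a [a0 a1] ha] := arc_inside_ball (xo01 ni.2) (psi0 ni.2 ni.1.+1 isT).
  by exists a.
pose A n i := arc_event (b i ^ n.+1) (a (n, i)) (a (n, i) + r n i).
pose box (B : 'I_d -> set (measurableTypeR R)) :=
  [set x : d.-tuple (measurableTypeR R) | forall i, B i (tnth x i)].
pose D := box (fun=> `[0, 1[%classic); pose E n := box (A n).
pose p n := \prod_i r n i.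
have mA n i : measurable (A n i) by exact: measurable_arc_event.
have mD : measurable D.
  by apply: (@measurable_tuple_box R d (fun=> `[0, 1[%classic)) => i; exact: measurable_itv.
have mEn n : measurable (E n) by exact: (measurable_tuple_box (mA n)).
have muD : m D = 1%E.
  rewrite -mE lebesgue_nd_box//.
  rewrite big1// => i _; rewrite lebesgue_measure_itv/= lte_fin ltr01.
  by rewrite oppr0 adde0.
have ED n : E n `<=` D by move=> x xE i; have [] := xE i.
have q0 n i : (0 < b i ^ n.+1)%N by rewrite expn_gt0 (ltnW (b2 i)).
have muE n : m (E n) = (p n)%:E.
  rewrite -mE lebesgue_nd_box// -prodEFin; apply: eq_bigr => i _.
  have [[a0 a1] _] := ha (n, i).
  by rewrite measure_arc_event ?lerDl ?(ltW (r0 _ _))// addrAC subrr add0r.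
have p0 n : 0 <= p n by apply: prodr_ge0 => i _; exact: ltW.
(* The factor [2 ^+ d] comes from expanding the product over coordinates, the factor [2] from the
   error [e] below. *)
pose C : R := 2 ^+ d * 2.
have d1 : 1 <= 2 ^+ d :> R by rewrite exprn_ege1// ler1n.
have C0 : 0 <= C by rewrite mulr_ge0// (le_trans ler01).
have lt_case k n : (k < n)%N ->
    (m (E k `&` E n) <= (p k * p n + C * (p n * 2^-1 ^+ (n - k)))%:E)%E.
  (* The correlation error of one coordinate; [k < n] makes it at most [1], as [prod_addr_le]
     requires. *)
  move=> kn; pose e : R := 2 * 2^-1 ^+ (n - k).
  have e01 : 0 <= e <= 1.
    rewrite mulr_ge0 ?exprn_ge0//= /e -(subnSK kn) exprS mulrA divff// mul1r.
    by rewrite exprn_ile1//; lra.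
  have -> : E k `&` E n = box (fun i => A k i `&` A n i).
    by apply/seteqP; split=> [x [xk xn] i|x xkn];
      [split; [exact: xk|exact: xn]|split=> i; have [] := xkn i].
  rewrite -mE; apply: (@le_trans _ _ (\prod_i ((r k i + e) * r n i))%:E).
    apply: lebesgue_nd_box_le => i; first exact: measurableI.
    have [[a0 _] _] := ha (k, i).
    apply: le_trans (measure_arc_eventI_le _ _ _ _ _) _ => //;
      rewrite ?lerDl ?(ltW (r0 _ _)) ?ltnS ?(ltnW kn)//.
    by rewrite (addrAC (a (k, i))) (addrAC (a (n, i))) !subrr !add0r subSS /e exprVn.
  rewrite lee_fin big_split/= -/(p n).
  have := prod_addr_le (r := r k) _ e01; rewrite -/(p k) => H.
  apply: (@le_trans _ _ ((p k + (2 ^+ d - 1) * e) * p n)).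
    by rewrite ler_wpM2r// H// => i; rewrite r1 ltW.
  rewrite mulrDl lerD2l (_ : C * _ = 2 ^+ d * e * p n); last by rewrite /C /e; ring.
  by rewrite ler_wpM2r// ler_wpM2r ?(andP e01).1//; lra.
(* The error involves only the later event; adding [p] of the earlier one makes it symmetric. On the
   diagonal [p n] alone is absorbed because [C >= 1]. *)
have muEI k n : (m (E k `&` E n) <=
    (p k * p n + C * ((p k + p n) * 2^-1 ^+ ((n - k) + (k - n))))%:E)%E.
  have h0 i : 0 <= 2^-1 ^+ i :> R by rewrite exprn_ge0.
  case: (ltngtP k n) => [kn|nk|->].
  - apply: (le_trans (lt_case _ _ kn)); rewrite lee_fin lerD2l ler_wpM2l//.
    rewrite (eqP (ltnW kn : k - n == 0)%N) addn0 ler_wpM2r//.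
    by rewrite lerDr.
  - rewrite setIC; apply: (le_trans (lt_case _ _ nk)).
    rewrite lee_fin mulrC lerD2l ler_wpM2l//.
    rewrite (eqP (ltnW nk : n - k == 0)%N) add0n ler_wpM2r//.
    by rewrite lerDl.
  - rewrite setIid muE lee_fin subnn expr0 mulr1.
    rewrite -[leLHS]add0r lerD ?mulr_ge0//.
    apply: (@le_trans _ _ (p n + p n)); first by rewrite lerDl.
    by rewrite ler_peMl ?addr_ge0// /C; lra.
have L1 := measure_lim_sup_set_eq1 mD muD mEn ED muE C0 muEI rD.
have mS := @measurable_shrinking_target R d b xo psi.
(* The closed unit cube gives the upper bound; the lower bound holds because the limsup of the [E n]
   lies in the target set, index [n] standing for exponent [n.+1]. *)
rewrite mE; apply/eqP; rewrite eq_le; apply/andP; split.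
  pose D1 := box (fun=> `[0, 1]%classic).
  apply: (@le_trans _ _ (m D1)).
    apply: le_measure; rewrite ?inE//.
      by apply: (@measurable_tuple_box R d (fun=> `[0, 1]%classic)) => i; exact: measurable_itv.
    by move=> x [x01 _] i; rewrite /= in_itv/= x01.
  rewrite -mE; have := @lebesgue_nd_box_le R d (fun=> `[0, 1]%classic) (fun=> 1).
  rewrite big1//; apply=> i; first exact: measurable_itv.
  by rewrite lebesgue_measure_itv/= lte_fin ltr01 oppr0 adde0.
rewrite -L1; apply: le_measure; rewrite ?inE//.
  apply: bigcap_measurable; first by exists 0%N.
  by move=> N _; exact: bigcup_measurable.
move=> x xL; split.
  by move=> i; have [n _ /(_ i)[]] := xL 0%N I; rewrite /= in_itv/= => /andP[-> /ltW].
move=> N; have [n Nn xn] := xL N I; exists n.+1; split; first exact: leqW.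
move=> i; rewrite iter_times_mod1//; have [_] := xn i.
rewrite /in_arc /= in_itv/=; have [_ ball] := ha (n, i); exact: ball.
Qed.

Unset Implicit Arguments.

(** Boundedness for [2 <= d] excludes cases such as [2 ^ n] and [2 ^ (- n)] for two coordinates: the
    products are [1] and the series diverges, yet the second coordinate alone confines the set to a
    null set. *)
Theorem theorem2p6 (R : realType) (d : nat) (hd : (0 < d)%N)
    (b : 'I_d -> nat) (hb : forall i, (2 <= b i)%N)
    (xo : d.-tuple R) (hxo : forall i, 0 <= tnth xo i <= 1)
    (psi : 'I_d -> nat -> R)
    (hpsi : forall i n, (1 <= n)%N -> 0 < psi i n) :
  ((\sum_(1 <= n <oo) (\prod_(i < d) psi i n)%:E < +oo)%E ->
     lebesgue_nd R d (shrinking_target b xo psi) = 0%E) /\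
  (((2 <= d)%N ->
      forall i, exists M : R, forall n, (1 <= n)%N -> psi i n <= M) ->
   (\sum_(1 <= n <oo) (\prod_(i < d) psi i n)%:E = +oo)%E ->
     lebesgue_nd R d (shrinking_target b xo psi) = 1%E).
Proof.
split.
  by apply: lebesgue_nd_shrinking_target_eq0 => // i; exact/ltnW/hb.
move=> bounded soo; apply: lebesgue_nd_shrinking_target_eq1 => //.
apply: (diverges_prod_min (f := fun i n => psi i n.+1)) => //.
- by move=> i n; exact: hpsi.
- by move=> /bounded bd i; have [M hM] := bd i; exists M => n; exact: hM.
apply: nneseries_pinfty_diverges.
  by move=> n; apply: prodr_ge0 => i _; exact/ltW/hpsi.
rewrite -soo nneseries_succ// => n n1.
by rewrite lee_fin prodr_ge0// => i _; exact/ltW/hpsi.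
Qed.
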